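(* Consider the fractional partial differential equation $$\sum_{i=0}^{m}\lambda_i\frac{\partial^{\alpha+i}f(x,t)}{\partial t^{\alpha+i}}=N[f(x,t)]=N\left(x,f,\frac{\partial^{\beta}f}{\partial x^{\beta}},\dots,\frac{\partial^{\beta+k}f}{\partial x^{\beta+k}}\right),\qquad(\ast)$$ where $N[f]$ is a linear or nonlinear differential operator, $\frac{\partial^{\alpha+i}f}{\partial t^{\alpha+i}}$ ($i=0,1,\dots,m$) and $\frac{\partial^{\beta+j}f}{\partial x^{\beta+j}}$ ($j=0,\dots,k$) are Caputo time and space derivatives respectively, of orders with $\alpha,\beta>0$, $\lfloor\alpha\rfloor=r$, $\lfloor\beta\rfloor=s$ where $r,s\in\mathbb{N}$, and $\lambda_i\in\mathbb{R}$. Let $\phi_0(x),\dots,\phi_n(x)$ be linearly independent functions. If the finite dimensional linear space $$I_{n+1}=\left\{\sum_{j=0}^{n}k_j\phi_j(x)\ \Big|\ k_0,\dots,k_n\in\mathbb{R}\right\}$$ is invariant under the operator $N$, then the equation $(\ast)$ has a solution of the form $$f(x,t)=\sum_{j=0}^{n}K_j(t)\phi_j(x),$$ where the coefficients $K_0,\dots,K_n$ satisfy the following system of fractional differential equations: $$\sum_{i=0}^{m}\lambda_i\frac{d^{\alpha+i}K_j(t)}{dt^{\alpha+i}}=\psi_j(K_0(t),K_1(t),\dots,K_n(t)),\qquad j=0,1,\dots,n.$$ Here $\psi_0,\dots,\psi_n$ are the expansion coefficients of $N[f]$ with respect to the basis $\phi_0,\dots,\phi_n$, i.e. $$N\left[\sum_{j=0}^{n}k_j\phi_j(x)\right]=\sum_{j=0}^{n}\psi_j(k_0,k_1,\dots,k_n)\,\phi_j(x)\qquad\text{for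 } k_0,\dots,k_n\in\mathbb{R}.$$
   Context: The Caputo fractional derivative of order $\gamma>0$ of $g\in C^{p}([a,b],\mathbb{R})$ is $$\frac{d^{\gamma}g(t)}{dt^{\gamma}}=\frac{1}{\Gamma(p-\gamma)}\int_a^t\frac{g^{(p)}(\tau)}{(t-\tau)^{\gamma-p+1}}\,d\tau\quad(p-1<\gamma<p),\qquad \frac{d^{\gamma}g(t)}{dt^{\gamma}}=g^{(p)}(t)\quad(\gamma=p),$$ with $p$ a positive integer. Partial Caputo derivatives are Caputo derivatives in the indicated variable with the other variable held fixed. A finite dimensional linear space $I$ of functions of $x$ is invariant with respect to a differential operator $N$ if $N[g]\in I$ for all $g\in I$. The operator $N$ acts in the variable $x$. Here $\mathbb{N}$ in the condition on $r,s$ is understood to include $0$.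
   Formalization: Existence of a solution fails in general (all λ_i = 0, φ_0 = 1, N[g] = 1 gives 0 = 1); proved instead: the ψ_j exist uniquely, and f = Σ K_j φ_j solves (∗) if and only if the K_j solve the system, with equations taken away from the base points of the Caputo derivatives. *)

(* Defs.v *)
From HB Require Import structures.
From mathcomp Require Import all_boot all_order all_algebra.
From mathcomp Require Import all_classical all_reals all_analysis.

Set Implicit Arguments.
Unset Strict Implicit.
Unset Printing Implicit Defensive.

Import Order.TTheory GRing.Theory Num.Theory.
Import numFieldNormedType.Exports.

Local Open Scope classical_set_scope.
Local Open Scope ring_scope.

Section Caputo.
Context {R : realType}.
Implicit Types (a b c d x t γ : R) (g : R -> R).

Definition diff_quot g x (y : R) : R := (g y - g x) / (y - x).

(* Derivative relative to A: on a closed interval it is the two-sided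
   derivative at interior points and the one-sided one at the endpoints. *)
Definition deriv_on (A : set R) g x : R :=
  lim (diff_quot g x y @[y --> within A x^']).

Definition derivn_on (A : set R) (p : nat) g : R -> R := iter p (deriv_on A) g.

(* g is of class C^p on [a, b]; only the values of g on [a, b] matter. *)
Definition Cp (p : nat) a b g : Prop :=
  (forall i : nat, (i < p)%N -> forall x, x \in `[a, b] ->
     cvg (diff_quot (derivn_on `[a, b] i g) x y @[y --> within `[a, b] x^'])) /\
  {within `[a, b], continuous (derivn_on `[a, b] p g)}.

Definition Gamma (z : R) : R :=
  \int[lebesgue_measure]_(u in `]0, +oo[) (u `^ (z - 1) * expR (- u)).

(* For γ > 0, the positive integer p with p - 1 < γ <= p. *)
Definition caputo_order γ : nat := `|Num.ceil γ|%N.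

(* Caputo derivative of order γ > 0 with base point a, for g of class
   C^(caputo_order γ) on [a, b]. *)
Definition caputo a b γ g t : R :=
  let p := caputo_order γ in
  if γ == p%:R then derivn_on `[a, b] p g t
  else (Gamma (p%:R - γ))^-1 *
    \int[lebesgue_measure]_(τ in `[a, t])
      (derivn_on `[a, b] p g τ / (t - τ) `^ (γ - p%:R + 1)).

Definition lincomb (n : nat) (φ : 'I_n.+1 -> R -> R) (k : 'I_n.+1 -> R) : R -> R :=
  fun x => \sum_(j < n.+1) k j * φ j x.

Definition lin_indep_on (A : set R) (n : nat) (φ : 'I_n.+1 -> R -> R) : Prop :=
  forall k : 'I_n.+1 -> R,
    (forall x, A x -> lincomb φ k x = 0) -> forall j, k j = 0.

Definition lin_span (n : nat) (φ : 'I_n.+1 -> R -> R) : set (R -> R) :=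
  range (lincomb φ).

(* The operator N[g](x) = F(x, g, D^β g, ..., D^(β+k) g), acting in x. *)
Definition diff_op c d β (k : nat) (F : R -> R -> ('I_k.+1 -> R) -> R) g : R -> R :=
  fun x => F x (g x) (fun j => caputo c d (β + j%:R) g x).

(* All equations below are imposed away from the base points of the Caputo
   derivatives (x in ]c, d], t in ]a, b]): at a base point the integral
   degenerates to 0. *)

Definition invariant_on (A : set R) (I : set (R -> R)) (N : (R -> R) -> R -> R) : Prop :=
  forall g, I g -> exists2 h, I h & forall x, A x -> N g x = h x.

Definition time_op a b α (m : nat) (λ : 'I_m.+1 -> R) (u : R -> R) t : R :=
  \sum_(i < m.+1) λ i * caputo a b (α + i%:R) u t.

(* f x t stands for f(x, t); a solution is required to have the regularity
   in each variable that makes all the Caputo derivatives defined. *)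
Definition solves_fpde a b c d α (m : nat) (λ : 'I_m.+1 -> R)
    β (k : nat) (F : R -> R -> ('I_k.+1 -> R) -> R) (f : R -> R -> R) : Prop :=
  [/\ forall x, x \in `[c, d] -> Cp (caputo_order (α + m%:R)) a b (f x),
      forall t, t \in `[a, b] -> Cp (caputo_order (β + k%:R)) c d (f^~ t) &
      forall x t, x \in `]c, d] -> t \in `]a, b] ->
        time_op a b α λ (f x) t = diff_op c d β F (f^~ t) x].

Definition expansion_coefs c d β (k : nat) (F : R -> R -> ('I_k.+1 -> R) -> R)
    (n : nat) (φ : 'I_n.+1 -> R -> R)
    (ψ : 'I_n.+1 -> ('I_n.+1 -> R) -> R) : Prop :=
  forall (kk : 'I_n.+1 -> R) x, x \in `]c, d] ->
    diff_op c d β F (lincomb φ kk) x = \sum_(j < n.+1) ψ j kk * φ j x.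

Definition solves_fode_system a b α (m : nat) (λ : 'I_m.+1 -> R)
    (n : nat) (ψ : 'I_n.+1 -> ('I_n.+1 -> R) -> R) (K : 'I_n.+1 -> R -> R) : Prop :=
  (forall j, Cp (caputo_order (α + m%:R)) a b (K j)) /\
  (forall j t, t \in `]a, b] -> time_op a b α λ (K j) t = ψ j (K^~ t)).

End Caputo.

(* Main.v *)
(** Caputo derivatives are linear on functions of class C^p: the integrand is a
    continuous function times the kernel (t - τ)^-θ with 0 < θ < 1, which is
    integrable although unbounded at τ = t. Hence for f = Σ_j K_j φ_j both sides
    of the equation at (x, t) are linear combinations of the φ_j(x), with
    coefficients Σ_i λ_i D^(α+i) K_j(t) and ψ_j(K(t)). The φ_j are continuous, so
    they stay independent on ]c, d] and the coefficients can be compared. The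
    regularity of K is recovered from that of f by choosing points x_i with
    (φ_j(x_i)) invertible: then each K_j is a combination of the f(x_i, .). *)

Require Import Defs.
From HB Require Import structures.
From mathcomp Require Import all_boot all_order all_algebra.
From mathcomp Require Import all_classical all_reals all_analysis.
From mathcomp Require Import measurable_realfun lra.

Set Implicit Arguments.
Unset Strict Implicit.
Unset Printing Implicit Defensive.

Import Order.TTheory GRing.Theory Num.Theory.
Import numFieldNormedType.Exports.

Local Open Scope classical_set_scope.
Local Open Scope ring_scope.

(** * Derivatives relative to a closed interval, and linearity of the class C^p *)

Section RelativeDerivative.
Context {R : realType}.
Implicit Types (A : set R) (a b x : R) (f g : R -> R).

(** Properness of the punctured filter gives uniqueness of limits, so that [lim] in [deriv_on] can
    be computed by proving a convergence. Every ball around [x] meets the interval to the right of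
    [x] if [x < b], to the left if [x = b]. *)
Lemma within_itv_dnbhs_proper a b x : a < b -> x \in `[a, b] ->
  ProperFilter (within `[a, b] x^').
Proof.
rewrite in_itv/= => ab /andP[ax xb]; apply: Build_ProperFilter_ex => P.
rewrite /within/= /dnbhs/= /within/= => /nbhs_ballP[e /= e0 eP].
have [xltb|bx] := ltP x b.
(* Halving makes the step strictly smaller than the radius [e] while staying inside the interval. *)
- pose h := Num.min e (b - x) / 2.
  have h0 : 0 < h by rewrite divr_gt0// lt_min e0 subr_gt0.
  have he : h < e by rewrite /h ltr_pdivrMr// gt_min ltr_pMr// ltr1n.
  have hb : h <= b - x.
    by rewrite /h ler_pdivrMr// ge_min ler_peMr ?orbT// ?subr_ge0// ler1n.
  exists (x + h); apply: eP => /=.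
  + by rewrite /ball/= opprD addNKr normrN gtr0_norm.
  + by rewrite gt_eqF// ltrDl.
  + by rewrite in_itv/=; apply/andP; split; lra.
- pose h := Num.min e (x - a) / 2.
  have xa : 0 < x - a by rewrite subr_gt0 (lt_le_trans ab).
  have h0 : 0 < h by rewrite divr_gt0// lt_min e0.
  have he : h < e by rewrite /h ltr_pdivrMr// gt_min ltr_pMr// ltr1n.
  have hb : h <= x - a.
    by rewrite /h ler_pdivrMr// ge_min ler_peMr ?orbT// ?ltW// ltr1n.
  exists (x - h); apply: eP => /=.
  + by rewrite /ball/= subKr gtr0_norm.
  + by rewrite lt_eqF// ltrBlDr ltrDl.
  + by rewrite in_itv/=; apply/andP; split; lra.
Qed.

Lemma eq_cvg_diff_quot A f g x (l : R) : Filter (within A x^') ->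
  A x -> {in A, f =1 g} ->
  diff_quot g x y @[y --> within A x^'] --> l ->
  diff_quot f x y @[y --> within A x^'] --> l.
Proof.
move=> FA Ax fg; apply: cvg_trans; apply: near_eq_cvg.
rewrite /prop_near1 nbhs_simpl /within/=; apply: nearW => y Ay.
by rewrite /diff_quot !fg// inE.
Qed.

Lemma cvg_diff_quot_lincomb A x n (g : 'I_n.+1 -> R -> R) (k : 'I_n.+1 -> R) :
  ProperFilter (within A x^') ->
  (forall j, cvg (diff_quot (g j) x y @[y --> within A x^'])) ->
  diff_quot (lincomb g k) x y @[y --> within A x^'] -->
    lincomb (fun j => deriv_on A (g j)) k x.
Proof.
move=> pF cg.
have -> : diff_quot (lincomb g k) x =
    fun y => \sum_(j < n.+1) k j * diff_quot (g j) x y.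
  apply/funext => y; rewrite /diff_quot /lincomb -sumrB mulr_suml.
  by apply: eq_bigr => j _; rewrite -mulrBr mulrA.
apply: cvg_big => [|j _]; first by apply: add_continuous.
by apply: cvgMr; exact: cg.
Qed.

(** Away from [x], [g y] equals [g x] plus the difference quotient times [y - x]; the quotient
    converges and [y - x] tends to 0. *)
Lemma within_continuous_diff_quot A g x : Filter (within A x^') ->
  cvg (diff_quot g x y @[y --> within A x^']) ->
  g y @[y --> within A (nbhs x)] --> g x.
Proof.
move=> pF /cvg_ex[l gl].
have xx : (y - x) @[y --> within A x^'] --> (0 : R).
  rewrite -(subrr x); apply: cvgB; last exact: cvg_cst.
  move=> W Wx; rewrite nbhs_simpl /= /within /= /dnbhs /within /=.
  by apply: filterS Wx => y Wy _ _.
have H : g y @[y --> within A x^'] --> g x.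
  have : (g x + diff_quot g x y * (y - x)) @[y --> within A x^'] --> g x.
    rewrite -[X in _ --> X]addr0 -(mulr0 l).
    by apply: cvgD; [exact: cvg_cst|exact: cvgM].
  apply: cvg_trans; apply: near_eq_cvg.
  rewrite /prop_near1 nbhs_simpl /within/=.
  apply: filterS (nbhs_dnbhs_neq x) => y yx _.
  by rewrite /diff_quot divfK ?subr_eq0// addrC subrK.
(* Passing from the punctured to the full neighbourhood only adds [y = x], where [g x] lies in its
   neighbourhood [W]. *)
move=> W Wg; have := H _ Wg.
rewrite -[X in X -> _]/(nbhs x (fun y => y != x -> A y -> W (g y))).
rewrite -[X in _ -> X]/(nbhs x (fun y => A y -> W (g y))).
apply: filterS => y yW Ay.
by have [->|/yW/(_ Ay)] := eqVneq y x; first exact: nbhs_singleton.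
Unshelve. all: by end_near. Qed.

Lemma Cp_differentiable_continuous p a b g i : a < b -> (i < p)%N ->
  Cp p a b g -> {within `[a, b], continuous (derivn_on `[a, b] i g)}.
Proof.
move=> ab ip [dg _]; apply/subspace_continuousP => x xab.
by apply: within_continuous_diff_quot; exact: dg.
Qed.

Lemma leq_Cp p q a b g : a < b -> (q <= p)%N -> Cp p a b g -> Cp q a b g.
Proof.
move=> ab; rewrite leq_eqVlt => /predU1P[->//|qp] gp; split.
  by move=> i iq; apply: gp.1; exact: ltn_trans qp.
exact: Cp_differentiable_continuous qp gp.
Qed.

Lemma derivn_on_lincomb p a b n (g : 'I_n.+1 -> R -> R) (k : 'I_n.+1 -> R) i :
  a < b -> (forall j, Cp p a b (g j)) -> (i <= p)%N ->
  {in `[a, b], derivn_on `[a, b] i (lincomb g k) =1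
               lincomb (fun j => derivn_on `[a, b] i (g j)) k}.
Proof.
move=> ab gp; elim: i => [//|i ih] ip x xab.
have pF := within_itv_dnbhs_proper ab xab.
rewrite /derivn_on iterS -!/(derivn_on _ _ _) {1}/deriv_on.
apply: cvg_lim => //.
(* The induction hypothesis holds only on the interval; this suffices because the quotients are
   taken between points of it. *)
apply: (@eq_cvg_diff_quot _ _
  (lincomb (fun j => derivn_on `[a, b] i (g j)) k)) => //.
  by move=> y /set_mem yab; apply: ih => //; exact: ltnW.
apply: cvg_diff_quot_lincomb => j.
by apply: (gp j).1.
Qed.

Lemma Cp_lincomb p a b n (g : 'I_n.+1 -> R -> R) (k : 'I_n.+1 -> R) :
  a < b -> (forall j, Cp p a b (g j)) -> Cp p a b (lincomb g k).
Proof.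
move=> ab gp; split=> [i ip x xab|].
- have pF := within_itv_dnbhs_proper ab xab.
  apply/cvg_ex; exists (lincomb (fun j => derivn_on `[a, b] i.+1 (g j)) k x).
  apply: (@eq_cvg_diff_quot _ _
    (lincomb (fun j => derivn_on `[a, b] i (g j)) k)) => //.
    by move=> y /set_mem yab; apply: derivn_on_lincomb => //; exact: ltnW.
  by apply: cvg_diff_quot_lincomb => j; apply: (gp j).1.
- apply: (subspace_eq_continuous
    (f := lincomb (fun j => derivn_on `[a, b] p (g j)) k)).
    by move=> y /set_mem yab; apply/esym; exact: derivn_on_lincomb.
  apply/subspace_continuousP => x xab.
  apply: cvg_big => [|j _]; first by apply: add_continuous.
  by apply: cvgMr; move: x xab; apply/subspace_continuousP; exact: (gp j).2.
Qed.

End RelativeDerivative.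

(** * Evaluation matrices and comparison of coefficients *)

Section LinearIndependence.
Context {R : realType}.

Lemma lin_indep_on_row_free (A : set R) n (φ : 'I_n.+1 -> R -> R) :
  lin_indep_on A φ -> forall m, (m <= n.+1)%N ->
  exists2 x : 'I_m -> R, (forall i, A (x i)) &
    row_free (\matrix_(i < m, j < n.+1) φ j (x i)).
Proof.
move=> indep; elim=> [_|m ih mn].
  by exists (fun=> 0) => [[]//|]; rewrite /row_free flatmx0 mxrank0.
have [x Ax rx] := ih (ltnW mn); set M := \matrix_(i, j) _ in rx.
(* A vector k in the kernel of M gives a nonzero combination of the φ j; a point
   y where it does not vanish adds a row that is independent of those of M. *)
have [k k0 Mk] : exists2 k : 'cV[R]_n.+1, k != 0 & M *m k = 0.
  have : kermx M^T != 0.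
    by rewrite -mxrank_eq0 mxrank_ker mxrank_tr (eqP rx) subn_eq0 -ltnNge.
  case/rowV0Pn => v vM v0; exists v^T; first by rewrite trmx_eq0.
  by apply: trmx_inj; rewrite trmx_mul trmxK trmx0; apply/sub_kermxP.
have [y Ay ky] : exists2 y, A y & lincomb φ (fun j => k j 0) y != 0.
  apply: contrapT => nk; move/negP: k0; apply; apply/eqP/colP => j.
  rewrite mxE; apply: (indep (fun j => k j 0)) => y Ay.
  by apply: contrapT => /eqP ky; apply: nk; exists y.
pose v : 'rV[R]_n.+1 := \row_j φ j y.
have vM : ~~ (v <= M)%MS.
  (* If [v = D *m M], then [v *m k = D *m (M *m k) = 0], but [v *m k] is the value of the
     combination at [y]. *)
  apply/negP => /submxP[D vD]; move/eqP: ky; apply.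
  have := congr1 (fun B : 'rV_n.+1 => (B *m k) 0 0) vD.
  rewrite -mulmxA Mk mulmx0 !mxE => <-.
  by apply: eq_bigr => j _; rewrite !mxE mulrC.
have rvM : row_free (col_mx v M).
  rewrite /row_free eqn_leq rank_leq_row -addsmxE add1n.
  rewrite -[X in (X < _)%N](eqP rx) rank_ltmx// ltmxE.
  by rewrite addsmxSr addsmx_sub negb_and vM.
(* The new point gets index 0, since its row is on top in [col_mx v M]. *)
pose x' (i : 'I_m.+1) := if unlift ord0 i is Some i' then x i' else y.
exists x'; first by move=> i; rewrite /x'; case: unliftP.
suff -> : \matrix_(i < m.+1, j < n.+1) φ j (x' i) = col_mx v M by [].
apply/matrixP => i j; rewrite !mxE /x'.
case: splitP => i' ii'; rewrite !mxE.
  by rewrite (_ : i = ord0) ?unlift_none//; apply/val_inj; rewrite /= ii' ord1.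
by rewrite (_ : i = lift ord0 i') ?liftK//; apply/val_inj.
Qed.

(** With n+1 points the evaluation matrix is square and invertible. The rows of its inverse are
    weights that recover each coefficient of a combination of the [φ j] from its values at the
    points. *)
Lemma lin_indep_on_dual_points (A : set R) n (φ : 'I_n.+1 -> R -> R) :
  lin_indep_on A φ ->
  exists (x : 'I_n.+1 -> R) (w : 'I_n.+1 -> 'I_n.+1 -> R),
    (forall i, A (x i)) /\
    forall j l, \sum_(i < n.+1) w j i * φ l (x i) = (j == l)%:R.
Proof.
move=> /lin_indep_on_row_free/(_ n.+1 (leqnn _))[x Ax].
rewrite row_free_unit; set M := \matrix_(i, j) _ => Mu.
exists x, (fun j i => invmx M j i); split=> // j l.
have := congr1 (fun B : 'M[R]_n.+1 => B j l) (mulVmx Mu).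
by rewrite !mxE => <-; apply: eq_bigr => i _; rewrite !mxE.
Qed.

Lemma lincomb_inj_on (A : set R) n (φ : 'I_n.+1 -> R -> R)
    (k l : 'I_n.+1 -> R) : lin_indep_on A φ ->
  (forall x, A x -> lincomb φ k x = lincomb φ l x) -> k = l.
Proof.
move=> indep kl; apply/funext => j; apply/eqP; rewrite -subr_eq0; apply/eqP.
apply: (indep (fun j => k j - l j)) => x Ax.
rewrite /lincomb; under eq_bigr do rewrite mulrBl.
by rewrite sumrB; have := kl _ Ax; rewrite /lincomb => ->; rewrite subrr.
Qed.

(** A combination vanishing on []c, d]] also vanishes at [c], as its limit from the right. This
    matters because the equations are imposed only on []c, d]]. *)
Lemma lin_indep_on_half_open (c d : R) n (φ : 'I_n.+1 -> R -> R) : c < d ->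
  (forall j, {within `[c, d], continuous (φ j)}) ->
  lin_indep_on `[c, d] φ -> lin_indep_on `]c, d] φ.
Proof.
move=> cd cφ indep k k0; apply: indep => x.
rewrite /= in_itv/= le_eqVlt => /andP[/predU1P[<- _|cx xd]]; last first.
  by apply: k0; rewrite /= in_itv/= cx.
have H : lincomb φ k y @[y --> c^'+] --> lincomb φ k c.
  apply: cvg_big => [|j _]; first by apply: add_continuous.
  apply: cvgMr.
  by have /(continuous_within_itvP _ cd)[] := cφ j.
have H0 : lincomb φ k y @[y --> c^'+] --> (0 : R).
  apply: (cvg_trans (near_eq_cvg _) (cvg_cst _)).
  near=> y; rewrite /= k0//= in_itv/=; apply/andP; split; near: y.
    exact: nbhs_right_gt.
  exact: nbhs_right_le.
exact: (cvg_unique _ H H0).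
Unshelve. all: by end_near. Qed.

End LinearIndependence.

(** * Finite linear combinations under the integral, and the weakly singular kernel *)

Lemma Rintegral_sumZ d (T : measurableType d) (R : realType)
    (mu : {measure set T -> \bar R}) (D : set T) n
    (k : 'I_n.+1 -> R) (h : 'I_n.+1 -> T -> R) :
  measurable D -> (forall j, mu.-integrable D (EFin \o h j)) ->
  \int[mu]_(x in D) (\sum_(j < n.+1) k j * h j x) =
  \sum_(j < n.+1) k j * \int[mu]_(x in D) h j x.
Proof.
move=> mD ih.
have ikh j : mu.-integrable D (EFin \o (fun x => k j * h j x)).
  by have := integrableZl mD (k j) (ih j).
rewrite /Rintegral; under eq_integral do rewrite -sumEFin.
rewrite integral_sum//.
under eq_bigr do rewrite -(fineK (integrable_fin_num mD (ikh _))).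
rewrite sumEFin /=.
by apply: eq_bigr => j _; rewrite -/(Rintegral _ _ _) RintegralZl.
Qed.

Section WeaklySingularIntegral.
Context {R : realType}.
Notation mu := (@lebesgue_measure R).
Implicit Types (a t θ : R).

Lemma is_derive_powR_sub t x p : x < t ->
  is_derive x 1 (fun τ => (t - τ) `^ p) (- (p * (t - x) `^ (p - 1))).
Proof.
move=> xt.
have dp : is_derive (t - x) 1 (fun u : R => u `^ p) (p * (t - x) `^ (p - 1)).
  by apply: is_derive1_powR; rewrite subr_gt0.
have dt : is_derive x 1 (fun τ => t - τ) (-1).
  by apply: is_derive_eq; rewrite add0r mul1r.
have := is_derive1_comp (f := fun u : R => u `^ p) (g := fun τ => t - τ).
move=> /(_ _ _ _ dp dt).
by rewrite mulrN1.
Qed.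

Lemma is_derive_kernel_primitive t θ x : θ < 1 -> x < t ->
  is_derive x 1 (fun τ => - (1 - θ)^-1 * (t - τ) `^ (1 - θ)) ((t - x) `^ (- θ)).
Proof.
move=> θ1 xt; have dp := is_derive_powR_sub (1 - θ) xt.
apply: is_derive_eq.
rewrite (_ : 1 - θ - 1 = - θ); last by lra.
rewrite /GRing.scale/= mulrNN mulrA mulVf ?mul1r// lt0r_neq0//.
by rewrite subr_gt0.
Qed.

(** The primitive [P] stays finite at the singularity because [θ < 1]; this bounds the truncated
    integrals, and monotone convergence concludes. *)
Lemma integrable_weak_kernel a t θ : a < t -> 0 < θ -> θ < 1 ->
  mu.-integrable `[a, t] (EFin \o (fun τ => ((t - τ) `^ θ)^-1)).
Proof.
move=> at_ θ0 θ1.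
pose P τ := - (1 - θ)^-1 * (t - τ) `^ (1 - θ).
have mk (D : set R) : measurable_fun D (fun τ : R => (t - τ) `^ (- θ)).
  apply: (measurableT_comp (measurable_powR _)).
  exact: measurable_funB.
have mkE D : measurable_fun D (fun τ : R => ((t - τ) `^ (- θ))%:E).
  by apply/measurable_EFinP; exact: mk.
have -> : (fun τ => ((t - τ) `^ θ)^-1) = (fun τ => (t - τ) `^ (- θ)).
  by apply/funext => τ; rewrite powRN.
apply/integrableP; split; first exact: mkE.
under eq_integral do rewrite /= ger0_norm ?powR_ge0//.
(* Exhaust [a, t[ by the intervals [a, t - e i], where the kernel is continuous. *)
pose e (i : nat) : R := (t - a) / i.+2%:R.
have e0 i : 0 < e i by rewrite divr_gt0// subr_gt0.
pose S (i : nat) := `[a, t - e i]%classic.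
(* Strict already at [i = 0], since the denominator in [e] is [i + 2]. *)
have aS i : a < t - e i.
  rewrite ltrBrDl -ltrBrDr /e ltr_pdivrMr// ltr_pMr ?subr_gt0//.
  by rewrite ltr1n.
(* The integral is [P (t - e i) - P a], and [P] is nonpositive, so the bound is uniform in [i]. *)
have bound i : (\int[mu]_(x in S i) ((t - x) `^ (- θ))%:E <= (- P a)%:E)%E.
  have Sd x : x <= t - e i -> x < t by move=> /le_lt_trans; apply; rewrite ltrBlDr ltrDl.
  have cP x : x <= t - e i -> {for x, continuous P}.
    move=> /Sd /(is_derive_kernel_primitive θ1)[dP _].
    by apply: differentiable_continuous; apply/derivable1_diffP.
  rewrite (@continuous_FTC2 _ _ P)//.
  - rewrite -EFinB lee_fin -[leRHS]add0r lerD2r /P mulNr oppr_le0.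
    by rewrite mulr_ge0 ?powR_ge0// invr_ge0 subr_ge0 ltW.
  - apply: derivable_within_continuous => x; rewrite in_itv/= => /andP[_ /Sd xt].
    by have [] := is_derive_powR_sub (- θ) xt.
  - split.
    + move=> x; rewrite in_itv/= => /andP[_ /ltW/Sd].
      by move=> /(is_derive_kernel_primitive θ1)[].
    + by apply: cvg_at_right_filter; apply: cP; exact: ltW.
    + by apply: cvg_at_left_filter; apply: cP.
  - move=> x; rewrite in_itv/= => /andP[_ /ltW/Sd].
    move=> /(is_derive_kernel_primitive θ1) dP; rewrite derive1E.
    exact: derive_val.
have S_nd : nondecreasing_seq S.
  move=> i j ij; rewrite subsetEset /S => x /=.
  rewrite !in_itv/= => /andP[-> /= /le_trans]; apply.
  rewrite lerB// /e ler_pM2l ?subr_gt0// lef_pV2 ?posrE// ler_nat.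
  by rewrite !ltnS.
have US : \bigcup_i S i = `[a, t[%classic.
  apply/seteqP; split => x /=.
    move=> [i _]; rewrite /S /= !in_itv/= => /andP[-> /=] /le_lt_trans; apply.
    by rewrite ltrBlDr ltrDl.
  rewrite in_itv/= => /andP[ax xt].
  have [i ie] : exists i : nat, e i <= t - x.
    have := archi_boundP (x := (t - a) / (t - x)).
    rewrite divr_ge0 ?subr_ge0 ?ltW// => /(_ isT) H.
    exists (Num.bound ((t - a) / (t - x))).
    rewrite /e ler_pdivrMr// mulrC -ler_pdivrMr ?subr_gt0//.
    by rewrite (le_trans (ltW H))// ler_nat leqW.
  by exists i => //; rewrite /S/= in_itv/= ax/= lerBrDl -lerBrDr.
(* The singular endpoint [t] is a null set and is dropped. *)
rewrite -integral_itv_bndo_bndc; last exact: mkE.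
rewrite -US.
have cvS : (\int[mu]_(x in S i) ((t - x) `^ (- θ))%:E @[i --> \oo] -->
    \int[mu]_(x in \bigcup_i S i) ((t - x) `^ (- θ))%:E)%E.
  apply: ge0_nondecreasing_set_cvg_integral => //.
  - by move=> i; exact: measurable_itv.
  - by move=> i; exact: mkE.
  - by move=> i x _; rewrite lee_fin powR_ge0.
apply: (@le_lt_trans _ _ (- P a)%:E); last exact: ltry.
rewrite -(cvg_lim _ cvS)//; apply: lime_le; last exact: nearW.
by apply/cvg_ex; eexists; exact: cvS.
Qed.

(** By compactness [h] is bounded, and a bounded measurable factor preserves integrability. *)
Lemma integrable_continuous_weak_kernel a t θ (h : R -> R) :
  a < t -> 0 < θ -> θ < 1 -> {within `[a, t], continuous h} ->
  mu.-integrable `[a, t] (EFin \o (fun τ => h τ / (t - τ) `^ θ)).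
Proof.
move=> at_ θ0 θ1 ch.
have cpt := @segment_compact R a t.
have mh : measurable_fun (`[a, t] : set (measurableTypeR R)) h.
  by apply: subspace_continuous_measurable_fun => //; exact: measurable_itv.
have bh : [bounded h x | x in `[a, t]].
  have /compact_bounded[M [_ mrt]] := continuous_compact ch cpt.
  by exists M; split; rewrite ?num_real // => ? ? ? ?; exact: mrt.
have := integrableMr _ mh bh (integrable_weak_kernel at_ θ0 θ1).
by under [X in _ -> integrable _ _ X]eq_fun do rewrite /= EFinM; exact.
Qed.

End WeaklySingularIntegral.

(** * Linearity of the Caputo derivative and of the time operator *)

Section CaputoLinear.
Context {R : realType}.
Implicit Types (a b γ δ t : R).

Lemma caputo_order_itv γ : 0 < γ ->
  (caputo_order γ)%:R - 1 < γ <= (caputo_order γ)%:R.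
Proof.
move=> γ0; rewrite /caputo_order natr_absz gtr0_norm ?ceil_gt0//.
by have := ceil_itv γ; rewrite intrB.
Qed.

Lemma leq_caputo_order γ δ : 0 < γ -> γ <= δ ->
  (caputo_order γ <= caputo_order δ)%N.
Proof.
move=> γ0 γδ; rewrite /caputo_order -lez_nat !gez0_abs ?le_ceil//.
  by rewrite ltW// ceil_gt0 (lt_le_trans γ0).
by rewrite ltW// ceil_gt0.
Qed.

Lemma caputo_lincomb a b γ n (g : 'I_n.+1 -> R -> R) (k : 'I_n.+1 -> R) t :
  0 < γ -> t \in `]a, b] -> (forall j, Cp (caputo_order γ) a b (g j)) ->
  caputo a b γ (lincomb g k) t = lincomb (fun j => caputo a b γ (g j)) k t.
Proof.
rewrite in_itv/= => γ0 /andP[at_ tb] gp.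
have ab := lt_le_trans at_ tb.
rewrite /lincomb /caputo; set p := caputo_order γ in gp *.
have [_|γp] := eqVneq γ p%:R.
  by rewrite (derivn_on_lincomb k ab gp)// in_itv/= (ltW at_).
have /andP[pγ γp'] : p%:R - 1 < γ <= p%:R := caputo_order_itv γ0.
have sub τ : τ \in `[a, t] -> τ \in `[a, b].
  by rewrite !in_itv/= => /andP[-> /=] /le_trans; apply.
pose h j τ := derivn_on `[a, b] p (g j) τ / (t - τ) `^ (γ - p%:R + 1).
transitivity ((Gamma (p%:R - γ))^-1 *
    \int[lebesgue_measure]_(τ in `[a, t]) (\sum_(j < n.+1) k j * h j τ)).
  congr (_ * _); apply: eq_Rintegral => τ /set_mem/sub τab.
  rewrite (derivn_on_lincomb k ab gp)// mulr_suml.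
  by apply: eq_bigr => j _; rewrite mulrA.
(* Each term is integrable: the exponent [γ - p + 1] lies strictly between 0 and 1 because
   [p - 1 < γ < p]. *)
rewrite Rintegral_sumZ//; last first.
  move=> j; apply: integrable_continuous_weak_kernel => //.
  - by lra.
  - have : γ < p%:R by rewrite lt_neqAle γp.
    by lra.
  - apply: continuous_subspaceW (gp j).2 => τ; exact: sub.
by rewrite mulr_sumr; apply: eq_bigr => j _; rewrite mulrCA.
Qed.

Lemma time_op_lincomb a b α m (λ : 'I_m.+1 -> R) n
    (g : 'I_n.+1 -> R -> R) (k : 'I_n.+1 -> R) t :
  0 < α -> t \in `]a, b] ->
  (forall j, Cp (caputo_order (α + m%:R)) a b (g j)) ->
  time_op a b α λ (lincomb g k) t = lincomb (fun j => time_op a b α λ (g j)) k t.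
Proof.
move=> α0 tab gp.
have ab : a < b by move: tab; rewrite in_itv/= => /andP[]; exact: lt_le_trans.
have αi (i : 'I_m.+1) : 0 < α + i%:R by rewrite ltr_wpDr.
rewrite /time_op [RHS]/lincomb; under [RHS]eq_bigr do rewrite mulr_sumr.
rewrite exchange_big/=; apply: eq_bigr => i _.
rewrite caputo_lincomb//.
  by rewrite mulr_sumr; apply: eq_bigr => j _; rewrite mulrCA.
(* Regularity for the top order [α + m] covers every lower order [α + i]. *)
move=> j; apply: leq_Cp (gp j) => //; apply: leq_caputo_order => //.
by rewrite lerD2l ler_nat -ltnS.
Qed.

End CaputoLinear.

(** * Reduction of the equation to a system for the coefficients *)

(** The system can be unsolvable, for instance when all [λ i] vanish and [ψ] is a nonzero constant;
    hence an equivalence for each [K] rather than unconditional existence. Uniqueness of [ψ] makes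
    the system well defined. *)
Theorem theorem3p1 (R : realType) (a b c d : R) (hab : a < b) (hcd : c < d)
    (α β : R) (r s : nat) (hα : 0 < α) (hβ : 0 < β)
    (hr : Num.floor α = r%:Z) (hs : Num.floor β = s%:Z)
    (m k n : nat) (λ : 'I_m.+1 -> R)
    (F : R -> R -> ('I_k.+1 -> R) -> R)
    (φ : 'I_n.+1 -> R -> R)
    (hφ : forall j, Cp (caputo_order (β + k%:R)) c d (φ j))
    (hφ_indep : lin_indep_on `[c, d] φ)
    (hinv : invariant_on `]c, d] (lin_span φ) (diff_op c d β F)) :
  (exists! ψ : 'I_n.+1 -> ('I_n.+1 -> R) -> R, expansion_coefs c d β F φ ψ) /\
  (forall ψ : 'I_n.+1 -> ('I_n.+1 -> R) -> R, expansion_coefs c d β F φ ψ ->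
     forall K : 'I_n.+1 -> R -> R,
       solves_fpde a b c d α λ β F (fun x t => \sum_(j < n.+1) K j t * φ j x)
       <-> solves_fode_system a b α λ ψ K).
Proof.
have order_gt0 : (0 < caputo_order (β + k%:R))%N.
  by rewrite absz_gt0 gt_eqF// ceil_gt0 ltr_wpDr.
have indep : lin_indep_on `]c, d] φ.
  apply: lin_indep_on_half_open => // j.
  exact: (@Cp_differentiable_continuous _ _ _ _ _ 0%N hcd order_gt0 (hφ j)).
split.
  have coef kk : exists l, forall x, `]c, d]%classic x ->
      diff_op c d β F (lincomb φ kk) x = lincomb φ l x.
    have [|h [l _ <-] hl] := hinv (lincomb φ kk); first by exists kk.
    by exists l.
  (* Invariance gives a coefficient vector for each [kk] separately; choice collects them into one
     map. *)
  have [L hL] := choice coef.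
  exists (fun j kk => L kk j); split=> [kk x xcd|ψ hψ]; first exact: hL.
  apply/funext => j; apply/funext => kk.
  suff -> : L kk = (fun j => ψ j kk) by [].
  apply: (lincomb_inj_on indep) => x xcd.
  by rewrite -hL// hψ.
move=> ψ hψ K.
(* For fixed [x] the roles swap: the [K j] are the functions and the values [φ j x] the
   constants. *)
have fE x : (fun t => \sum_(j < n.+1) K j t * φ j x) = lincomb K (φ^~ x).
  by apply/funext => t; apply: eq_bigr => j _; rewrite mulrC.
have time_opE x t : t \in `]a, b] ->
    (forall j, Cp (caputo_order (α + m%:R)) a b (K j)) ->
    time_op a b α λ (fun t => \sum_(j < n.+1) K j t * φ j x) t =
    lincomb φ (fun j => time_op a b α λ (K j) t) x.
  move=> tab Kp; rewrite fE time_op_lincomb//.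
  by apply: eq_bigr => j _; rewrite mulrC.
split=> [[fp _ feq]|[Kp Keq]].
- have Kp j : Cp (caputo_order (α + m%:R)) a b (K j).
    have [x [w [xcd wE]]] := lin_indep_on_dual_points hφ_indep.
    (* The dual weights isolate [K j] from the time sections of [f] at the points [x i], which
       inherit regularity from [f]. *)
    have -> : K j = lincomb (fun i t => \sum_(l < n.+1) K l t * φ l (x i)) (w j).
      apply/funext => t; apply/esym.
      transitivity (\sum_(l < n.+1) K l t * (j == l)%:R).
        rewrite /lincomb; under eq_bigr do rewrite mulr_sumr.
        rewrite exchange_big/=; apply: eq_bigr => l _.
        by rewrite -wE mulr_sumr; apply: eq_bigr => i _; rewrite mulrCA.
      rewrite (bigD1 j)//= eqxx mulr1 big1 ?addr0// => l lj.
      by rewrite eq_sym (negbTE lj) mulr0.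
    by apply: Cp_lincomb => // i; apply: fp; exact: xcd.
  split=> // j t tab.
  (* At fixed [t] both vectors are coefficients of the same function on []c, d]]. *)
  suff /(congr1 (@^~ j)) : (fun j => time_op a b α λ (K j) t) = (ψ^~ (K^~ t)).
    exact.
  apply: (lincomb_inj_on indep) => x xcd.
  by rewrite -time_opE// feq// hψ.
- split=> [x xcd|t tab|x t xcd tab].
  + by rewrite fE; exact: Cp_lincomb.
  + exact: (Cp_lincomb (K^~ t) hcd hφ).
  + rewrite time_opE// hψ//; apply: eq_bigr => j _.
    by rewrite Keq.
Qed.
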